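(* Let $G$ be a connected graph and $K$ a finite connected graph having a pendant vertex (a vertex of degree $1$), and suppose $|V(K)|\cdot\Upsilon_{\rm v}(K,G)=\Upsilon^{\rm sym}_{\rm v}(K,G)>0$ (with these quantities finite). Then for every orbit $V$ of $G$, the induced subgraph $G(V)$ contains a subgraph isomorphic to $K$.
   Context: Graphs are undirected, without loops and multiple edges, and may be infinite. A set $M\subseteq V(G)$ is marked (for $K$) if every (not necessarily induced) subgraph of $G$ isomorphic to $K$ contains at least one vertex of $M$. $\Upsilon_{\rm v}(K,G)$ is the minimum cardinality of a marked set; $\Upsilon^{\rm sym}_{\rm v}(K,G)$ is the minimum cardinality of a marked set invariant under all automorphisms of $G$. The orbit of a vertex $v$ is $\{gv\mid g\in\mathrm{Aut}(G)\}$. For $V\subseteq V(G)$, $G(V)$ denotes the subgraph of $G$ induced by $V$. *)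

(* Defs.v *)
From mathcomp Require Import all_boot.
From mathcomp Require Import boolp classical_sets functions cardinality.
From Stdlib Require Import Relation_Operators.

Set Implicit Arguments.
Unset Strict Implicit.
Unset Printing Implicit Defensive.

Local Open Scope classical_set_scope.
Local Open Scope card_scope.

Record graph (V : Type) := Graph {
  adj : V -> V -> Prop;
  adj_sym : forall x y, adj x y -> adj y x;
  adj_irrefl : forall x, ~ adj x x }.

Definition graph_iso (V W : Type) (G : graph V) (H : graph W) (f : V -> W) : Prop :=
  bijective f /\ forall x y, adj G x y <-> adj H (f x) (f y).

Definition isomorphic (V W : Type) (G : graph V) (H : graph W) : Prop :=
  exists f : V -> W, graph_iso G H f.

Definition automorphism (V : Type) (G : graph V) (g : V -> V) : Prop :=
  graph_iso G G g.

Definition connected (V : Type) (G : graph V) : Prop :=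
  forall x y : V, clos_refl_trans V (adj G) x y.

Definition degree (T : finType) (K : graph T) (x : T) : nat :=
  #|[pred y | `[< adj K x y >]]|.

Definition pendant (T : finType) (K : graph T) (x : T) : Prop :=
  degree K x = 1.

Record subgraph (V : Type) (G : graph V) := Subgraph {
  sub_vset : set V;
  sub_edge : V -> V -> Prop;
  sub_edge_sym : forall x y, sub_edge x y -> sub_edge y x;
  sub_edgeP : forall x y, sub_edge x y -> [/\ sub_vset x, sub_vset y & adj G x y] }.

Section SubgraphAsGraph.
Variables (V : Type) (G : graph V).

Lemma sub_adj_sym (H : subgraph G) (x y : sub_vset H) :
  sub_edge H (val x) (val y) -> sub_edge H (val y) (val x).
Proof. exact: sub_edge_sym. Qed.

Lemma sub_adj_irrefl (H : subgraph G) (x : sub_vset H) :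
  ~ sub_edge H (val x) (val x).
Proof. by move=> xx; case: (sub_edgeP xx) => _ _; exact: adj_irrefl. Qed.

Definition graph_of_subgraph (H : subgraph G) : graph (sub_vset H) :=
  Graph (@sub_adj_sym H) (@sub_adj_irrefl H).

Lemma induced_sym (A : set V) (x y : V) :
  [/\ A x, A y & adj G x y] -> [/\ A y, A x & adj G y x].
Proof. by case=> Ax Ay xy; split=> //; exact: adj_sym. Qed.

Definition induced (A : set V) : subgraph G :=
  @Subgraph V G A (fun x y => [/\ A x, A y & adj G x y])
    (@induced_sym A) (fun _ _ xy => xy).

End SubgraphAsGraph.

Definition contains_copy (T V : Type) (K : graph T) (G : graph V) : Prop :=
  exists H : subgraph G, isomorphic K (graph_of_subgraph H).

Definition marked (T V : Type) (K : graph T) (G : graph V) (M : set V) : Prop :=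
  forall H : subgraph G, isomorphic K (graph_of_subgraph H) ->
    exists2 x, sub_vset H x & M x.

Definition aut_invariant (V : Type) (G : graph V) (M : set V) : Prop :=
  forall g : V -> V, automorphism G g -> g @` M = M.

Definition aut_orbit (V : Type) (G : graph V) (v : V) : set V :=
  [set g v | g in [set g | automorphism G g]].

(* The natural number n is the least cardinality of a member of F; members of F
   may be infinite, and no such n exists when F has no finite member. *)
Definition min_cardinality (V : Type) (F : set (set V)) (n : nat) : Prop :=
  (exists2 M, F M & M #= `I_n) /\ (forall M, F M -> `I_n #<= M).

Definition upsilon (T V : Type) (K : graph T) (G : graph V) (n : nat) : Prop :=
  min_cardinality [set M | marked K G M] n.

Definition upsilon_sym (T V : Type) (K : graph T) (G : graph V) (n : nat) : Prop :=
  min_cardinality [set M | marked K G M /\ aut_invariant G M] n.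

(* Main.v *)
(** Averaging over the automorphism group: for a finitely supported function
    [h] on the vertices, replacing [h] by [(h + h \o g) / 2] lowers its
    squared l2 norm by a definite amount unless [h] is nearly [g]-invariant.
    So [h] can be averaged until it is at most slightly above its orbit means,
    the mean over an infinite orbit being [0]; this replaces B. H. Neumann's lemma on coverings by
    cosets.  If [M] is marked, every copy of [K] therefore carries total mass
    at least [1] for the orbit means of the indicator of [M], and the set [S] of
    the vertices of mean at least [1 / #|T|] is marked, invariant and of
    cardinality at most [#|T| * #|M|].  In the case of equality all means are at
    most [1 / #|T|], so every copy of [K] lies in [S].  By minimality, [S]
    without an orbit [O] misses some copy of [K], which then lies in [O].
    Moving the image of the pendant vertex shows that [S] is closed under
    adjacency, hence is everything. *)
Require Import Defs.
From mathcomp Require Import all_boot.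
From mathcomp Require Import all_order all_algebra finmap lra.
From mathcomp Require Import boolp classical_sets functions cardinality.

Set Implicit Arguments.
Unset Strict Implicit.
Unset Printing Implicit Defensive.

Import Order.TTheory GRing.Theory Num.Theory.
Local Open Scope classical_set_scope.

(** * Copies of [K] as injective homomorphisms *)

Section Embeddings.
Context {T V : Type}.
Implicit Types (K : graph T) (G : graph V) (f : T -> V).

(** Unlike a subgraph, a map can be composed with automorphisms and altered at a single vertex. *)
Definition embedding K G f : Prop :=
  injective f /\ forall x y, adj K x y -> adj G (f x) (f y).

Lemma embedding_of_iso K G (H : subgraph G) :
  isomorphic K (graph_of_subgraph H) ->
  exists2 f, embedding K G f & range f = sub_vset H.
Proof.
case=> f [[f' fK f'K] fadj]; exists (fun t => val (f t)).
  split=> [x y /val_inj/(can_inj fK)//|x y /fadj xy].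
  by case: (sub_edgeP xy).
apply/seteqP; split=> [_ [t _ <-]|x Hx]; first exact: set_valP.
by exists (f' (SigSub (mem_set Hx))) => //; rewrite f'K.
Qed.

Lemma iso_of_embedding K G f : embedding K G f ->
  exists2 H : subgraph G, isomorphic K (graph_of_subgraph H) &
    sub_vset H = range f.
Proof.
case=> finj fadj.
(* Only images of edges of [K] are kept, since a copy need not be induced. *)
pose E x y := exists s t, [/\ f s = x, f t = y & adj K s t].
have Esym x y : E x y -> E y x.
  by case=> s [t [<- <- st]]; exists t, s; split=> //; exact: adj_sym.
have EP x y : E x y -> [/\ range f x, range f y & adj G x y].
  by case=> s [t [<- <- st]]; split; [exists s|exists t|exact: fadj].
exists (Subgraph Esym EP) => //.
have rf t : f t \in range f by apply: mem_set; exists t.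
exists (fun t => SigSub (rf t) : range f); split.
  have pre (x : range f) : exists t, f t = val x.
    by case: (set_valP x) => t _ ft; exists t.
  have [f' f'P] := choice pre.
  by exists f' => x; [apply: finj; rewrite f'P|apply: val_inj; rewrite /= f'P].
move=> x y; split=> [xy|]; first by exists x, y.
by case=> s [t [/finj <- /finj <-]].
Qed.

Lemma embedding_aut K G f g :
  embedding K G f -> automorphism G g -> embedding K G (g \o f).
Proof.
case=> finj fadj [gbij gadj]; split; first exact: inj_comp (bij_inj gbij) finj.
by move=> x y /fadj/gadj.
Qed.

Lemma marked_embedding K G (M : set V) :
  marked K G M <-> forall f, embedding K G f -> exists t, M (f t).
Proof.
split=> [Mm f /iso_of_embedding[H HK fH]|Mm H /embedding_of_iso[f fe fH]].
  by have [x] := Mm H HK; rewrite fH => -[t _ <-]; exists t.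
by have [t Mft] := Mm f fe; exists (f t) => //; rewrite -fH; exists t.
Qed.

End Embeddings.

Lemma contains_copy_induced (T V : Type) (K : graph T) (G : graph V)
    (A : set V) (f : T -> V) :
  embedding K G f -> range f `<=` A ->
  contains_copy K (graph_of_subgraph (induced G A)).
Proof.
case=> finj fadj fA.
have fAt t : f t \in A by apply: mem_set; apply: fA; exists t.
have [|H HK _] := @iso_of_embedding T A K (graph_of_subgraph (induced G A))
                    (fun t => SigSub (fAt t)); last by exists H.
split=> [x y /(congr1 val) /= /finj//|x y /fadj xy].
by split=> //=; apply: set_mem.
Qed.

(** * Moving the pendant vertex of a copy *)

Section Pendant.
Variables (T : finType) (K : graph T) (x : T).
Hypothesis Kx : pendant K x.

Lemma pendant_neighbor :
  exists2 y, adj K x y & forall z, adj K x z -> z = y.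
Proof.
have /card1P[y yP] : #|[pred y | `[< adj K x y >]]| == 1 by apply/eqP.
exists y; first by have := yP y; rewrite !inE eqxx => /asboolP.
by move=> z /asboolP xz; have := yP z; rewrite !inE xz => /esym/eqP.
Qed.

(** The only edge of [K] at [x] goes to [y], so the edge from [f y] to [z] is all that adjacency
    requires; injectivity survives because [z] lies off the copy. *)
Lemma embedding_move_pendant (V : Type) (G : graph V) (f : T -> V) y z :
  adj K x y -> embedding K G f -> adj G (f y) z -> ~ range f z ->
  exists2 f', embedding K G f' & f' x = z.
Proof.
have [y' _ yu] := pendant_neighbor; move=> /yu -> [finj fadj] yz nz.
exists (fun t => if t == x then z else f t); last by rewrite eqxx.
split=> [s t|s t st].
  case: eqP => [->|_]; case: eqP => [->|_] //; last exact: finj.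
    by move=> zt; case: nz; exists t.
  by move=> zs; case: nz; exists s.
case: (eqVneq s x) st => [->|_]; case: (eqVneq t x) => [->|_] st.
- by case: (adj_irrefl st).
- by rewrite (yu _ st); exact: adj_sym.
- by rewrite (yu _ (adj_sym st)).
- exact: fadj.
Qed.

End Pendant.

(** * Automorphism orbits and invariant sets *)

Section Orbits.
Variables (V : Type) (G : graph V).
Implicit Types (g : V -> V) (v x : V).

Lemma automorphism_id : automorphism G id.
Proof. by split=> //; exists id. Qed.

Lemma automorphism_comp g h :
  automorphism G g -> automorphism G h -> automorphism G (g \o h).
Proof.
move=> [gb ga] [hb ha]; split; first exact: bij_comp.
by move=> x y; rewrite ha ga.
Qed.

Lemma automorphism_inv g : automorphism G g ->
  exists h, [/\ automorphism G h, cancel g h & cancel h g].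
Proof.
move=> [[h gh hg] ga]; exists h; split=> //; split; first by exists g.
by move=> x y; rewrite (ga (h x)) !hg.
Qed.

Lemma orbit_refl v : aut_orbit G v v.
Proof. by exists id => //; exact: automorphism_id. Qed.

Lemma orbit_sym v x : aut_orbit G v x -> aut_orbit G x v.
Proof.
by move=> [g /automorphism_inv[h [ha gh _]] <-]; exists h => //; rewrite gh.
Qed.

Lemma orbit_trans v x y :
  aut_orbit G v x -> aut_orbit G x y -> aut_orbit G v y.
Proof.
move=> [g ga <-] [h ha <-]; exists (h \o g) => //; exact: automorphism_comp.
Qed.

Lemma orbit_eq v x : aut_orbit G v x -> aut_orbit G x = aut_orbit G v.
Proof.
move=> vx; apply/seteqP; split=> y; first exact: orbit_trans vx.
exact/orbit_trans/orbit_sym.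
Qed.

Lemma aut_invariant_orbit (A : set V) : aut_invariant G A ->
  forall v, A v -> aut_orbit G v `<=` A.
Proof. by move=> Ai v Av _ [g ga <-]; rewrite -(Ai g ga); exists v. Qed.

Lemma orbit_aut_invariant (A : set V) :
  (forall v, A v -> aut_orbit G v `<=` A) -> aut_invariant G A.
Proof.
move=> Ao g ga; apply/seteqP; split=> [_ [v Av <-]|x Ax].
  by apply: Ao Av _ _; exists g.
have [h [ha gh hg]] := automorphism_inv ga.
by exists (h x); [apply: Ao Ax _ _; exists h|rewrite hg].
Qed.

End Orbits.

(** * Averaging of finitely supported functions, and orbit means *)

Section Averaging.
Variable V : choiceType.
Local Open Scope ring_scope.
Implicit Types (p h : V -> rat) (s : seq V) (g : V -> V).

Lemma sum_subseq_support p s s' : uniq s -> uniq s' -> {subset s <= s'} ->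
  (forall x, x \notin s -> p x = 0) -> \sum_(x <- s') p x = \sum_(x <- s) p x.
Proof.
move=> us us' ss' p0; rewrite (bigID (mem s)) /= [X in _ + X]big1 ?addr0//.
rewrite -big_filter; apply/perm_big/uniq_perm => //; first exact: filter_uniq.
by move=> x; rewrite mem_filter; case: (boolP (x \in s)) => // /ss' ->.
Qed.

(** [P] collects the properties to be kept through the averaging. The number of steps is bounded,
    since the squared norm starts below [N%:R * d] and cannot become negative. *)
Lemma near_invariant (Gamma : set (V -> V)) (P : (V -> rat) -> Prop) e p s :
  (forall g, Gamma g -> bijective g) ->
  (forall p g, P p -> Gamma g -> P (fun x => (p x + p (g x)) / 2)) ->
  0 < e -> P p -> (forall x, x \notin s -> p x = 0) ->
  exists q s', [/\ P q, forall x, x \notin s' -> q x = 0 &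
    forall g x, Gamma g -> `|q x - q (g x)| <= e].
Proof.
move=> Gb Pc e0 Pp sp.
have {sp} : forall x, x \notin undup s -> p x = 0.
  by move=> x; rewrite mem_undup; exact: sp.
move: (undup s) (undup_uniq s) => {}s us sp.
(* Each midpoint step lowers the squared l2 norm by more than [d], by the
   parallelogram law. *)
pose d : rat := e ^+ 2 / 4.
have d0 : 0 < d by rewrite /d; apply: divr_gt0 => //; exact: exprn_gt0.
have [N] : exists N : nat, \sum_(x <- s) p x ^+ 2 < N%:R * d.
  exists (Num.bound ((\sum_(x <- s) p x ^+ 2) / d)).
  rewrite -ltr_pdivrMr// archi_boundP// divr_ge0 ?(ltW d0)//.
  by apply: sumr_ge0 => x _; exact: sqr_ge0.
elim: N p s us Pp sp => [|N IH] p s us Pp sp ltN.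
  move: ltN; rewrite mul0r ltNge sumr_ge0// => x _; exact: sqr_ge0.
have [inv|] := pselect (forall g x, Gamma g -> `|p x - p (g x)| <= e).
  by exists p, s.
move=> /existsNP[g /existsNP[x /not_implyP[Gg /negP]]]; rewrite -ltNge => gx.
have [g' gK g'K] := Gb _ Gg.
(* The midpoint vanishes off [s] and its preimage under [g]. *)
pose s' := undup (s ++ map g' s).
apply: (IH (fun x => (p x + p (g x)) / 2) s'); [exact: undup_uniq|exact: Pc| |].
  move=> y; rewrite mem_undup mem_cat negb_or => /andP[ys yg].
  rewrite !sp ?addr0 ?mul0r//; apply: contra yg => gy.
  by apply/mapP; exists (g y); rewrite ?gK.
have sum1 : \sum_(y <- s') p y ^+ 2 = \sum_(y <- s) p y ^+ 2.
  apply: sum_subseq_support => //; first exact: undup_uniq.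
    by move=> y ys; rewrite mem_undup mem_cat ys.
  by move=> y /sp ->; rewrite expr0n.
have sum2 : \sum_(y <- s') p (g y) ^+ 2 = \sum_(y <- s) p y ^+ 2.
  rewrite -(big_map g xpredT (fun y => p y ^+ 2)).
  apply: sum_subseq_support => //.
  - by rewrite map_inj_uniq ?undup_uniq//; exact: can_inj gK.
  - move=> y ys; apply/mapP; exists (g' y); rewrite ?g'K//.
    by rewrite mem_undup mem_cat map_f ?orbT.
  - by move=> y /sp ->; rewrite expr0n.
have par : \sum_(y <- s') ((p y + p (g y)) / 2) ^+ 2 =
    \sum_(y <- s) p y ^+ 2 - \sum_(y <- s') (p y - p (g y)) ^+ 2 / 4.
  have -> : \sum_(y <- s) p y ^+ 2 =
      \sum_(y <- s') (p y ^+ 2 / 2 + p (g y) ^+ 2 / 2).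
    rewrite big_split /= -!mulr_suml sum1 sum2; lra.
  by rewrite -sumrB; apply: eq_bigr => y _; lra.
(* Otherwise [p] would vanish at both [x] and [g x], against the gap larger than [e]. *)
have xs' : x \in s'.
  rewrite mem_undup mem_cat; apply/contraT; rewrite negb_or => /andP[xs xg].
  move: gx; rewrite !sp ?subrr ?normr0 1?ltNge ?(ltW e0)//.
  by apply: contra xg => gy; apply/mapP; exists (g x); rewrite ?gK.
have : d < \sum_(y <- s') (p y - p (g y)) ^+ 2 / 4.
  rewrite (bigD1_seq x) ?undup_uniq//=.
  apply: (@lt_le_trans _ _ ((p x - p (g x)) ^+ 2 / 4)).
    rewrite /d ltr_pM2r ?invr_gt0// -[ltRHS]real_normK ?num_real//.
    by rewrite ltrXn2r ?nnegrE ?(ltW e0).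
  rewrite lerDl sumr_ge0// => y _; rewrite divr_ge0//; exact: sqr_ge0.
move: ltN; rewrite par -[N.+1]addn1 natrD mulrDl; lra.
Qed.

Variable G : graph V.

(* Over an infinite orbit [fset_set] is empty, so the mean is [0 / 0 = 0]. *)
Definition orbit_mean h v : rat :=
  (\sum_(x <- fset_set (aut_orbit G v)) h x) /
    #|` fset_set (aut_orbit G v)|%:R.

Lemma orbit_mean_infinite h v :
  infinite_set (aut_orbit G v) -> orbit_mean h v = 0.
Proof.
move=> iv; rewrite /orbit_mean /fset_set; case: pselect => //= ?.
by rewrite big_nil mul0r.
Qed.

Lemma orbit_mean_orbit h v x :
  aut_orbit G v x -> orbit_mean h x = orbit_mean h v.
Proof. by move=> vx; rewrite /orbit_mean (orbit_eq vx). Qed.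

(** An automorphism permutes each finite orbit, so the sum is only reindexed. *)
Lemma orbit_mean_aut h g v : automorphism G g ->
  orbit_mean (fun x => h (g x)) v = orbit_mean h v.
Proof.
move=> ga; have [fv|iv] := pselect (finite_set (aut_orbit G v)); last first.
  by rewrite !orbit_mean_infinite.
congr (_ / _); have [k [ka gk kg]] := automorphism_inv ga.
rewrite -(big_map g xpredT h); apply/perm_big/uniq_perm.
- by rewrite map_inj_uniq ?fset_uniq//; exact: can_inj gk.
- exact: fset_uniq.
have orbitM l y : automorphism G l -> aut_orbit G v y -> aut_orbit G v (l y).
  by move=> la vy; apply: orbit_trans vy _; exists l.
move=> x; apply/mapP/idP => [[y + ->]|].
  by rewrite !in_fset_set// !inE; exact: orbitM.
rewrite in_fset_set// inE => vx; exists (k x); rewrite ?kg//.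
by rewrite in_fset_set// inE; exact: orbitM.
Qed.

Lemma orbit_mean_midpoint h g v : automorphism G g ->
  orbit_mean (fun x => (h x + h (g x)) / 2) v = orbit_mean h v.
Proof.
move=> ga; rewrite {1}/orbit_mean -mulr_suml big_split /= -mulrA mulrCA mulrDl.
rewrite -/(orbit_mean _ _) -/(orbit_mean (fun x => h (g x)) v) orbit_mean_aut//.
by lra.
Qed.

Lemma orbit_card_gt0 v : finite_set (aut_orbit G v) ->
  (0 < #|` fset_set (aut_orbit G v)|)%N.
Proof.
move=> fv; rewrite cardfs_gt0; apply/fset0Pn; exists v.
by rewrite in_fset_set// inE; exact: orbit_refl.
Qed.

(** A finite orbit has a value not above its average; an infinite one leaves the finite support,
    where the value [0] equals the mean. *)
Lemma exists_le_orbit_mean h s v : (forall x, x \notin s -> h x = 0) ->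
  exists2 x, aut_orbit G v x & h x <= orbit_mean h v.
Proof.
move=> sh; have [fv|iv] := pselect (finite_set (aut_orbit G v)).
  apply: contrapT => /forall2NP hgt.
  suff : orbit_mean h v < orbit_mean h v by rewrite ltxx.
  rewrite {2}/orbit_mean ltr_pdivlMr ?ltr0n ?orbit_card_gt0//.
  rewrite mulr_natr -iter_addr_0 -count_predT -big_const_seq.
  rewrite big_seq [ltRHS]big_seq; apply: ltr_sum => [|x].
    apply/hasP; exists v; rewrite in_fset_set// inE; exact: orbit_refl.
  rewrite in_fset_set// inE => vx.
  by have [//|/negP] := hgt x; rewrite -ltNge.
have : infinite_set (aut_orbit G v `\` [set` s]).
  by apply: infinite_setD => //; exact: finite_seq.
move=> /infinite_setN0[x [vx /negP xs]]; exists x => //.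
by rewrite sh// orbit_mean_infinite.
Qed.

(** Both the bound [c] over all translates and the orbit means survive midpoint steps. Once [p] is
    nearly invariant, its value at [f i] is close to one that is not above the mean, and the total
    error [e] is arbitrary. *)
Lemma sum_le_orbit_means (I : finType) (f : I -> V) h s c :
  (forall x, x \notin s -> h x = 0) ->
  (forall g, automorphism G g -> c <= \sum_i h (g (f i))) ->
  c <= \sum_i orbit_mean h (f i).
Proof.
move=> sh ch; apply/ler_addgt0Pr => e e0.
pose P p := (forall g, automorphism G g -> c <= \sum_i p (g (f i))) /\
            (forall v, orbit_mean p v = orbit_mean h v).
(* The successor keeps the divisor positive for empty [I]; the [#|I|] errors still add up to at most
   [e]. *)
pose e' := e / #|I|.+1%:R.
have e'0 : 0 < e' by rewrite divr_gt0.
have Pc p g : P p -> automorphism G g -> P (fun x => (p x + p (g x)) / 2).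
  move=> [cp mp] ga; split=> [k ka|v]; last by rewrite orbit_mean_midpoint.
  rewrite -mulr_suml big_split /=; have := cp _ ka.
  have := cp _ (automorphism_comp ga ka); rewrite /comp; lra.
have [p [s' [[cp mp] s'p pinv]]] :=
  @near_invariant [set g | automorphism G g] P e' h s
    (fun g ga => proj1 ga) Pc e'0 (conj ch (fun=> erefl)) sh.
have pi i : p (f i) <= orbit_mean h (f i) + e'.
  have [x [g ga gx] px] := exists_le_orbit_mean (f i) s'p.
  have := pinv _ (f i) ga; rewrite gx ler_norml => /andP[_].
  rewrite -(mp (f i)); lra.
apply: (le_trans (cp _ (automorphism_id G))).
apply: (le_trans (ler_sum _ (fun i _ => pi i))).
rewrite big_split /= lerD2l sumr_const -mulr_natr /e' mulrAC.
by rewrite ler_pdivrMr ?ltr0n// ler_pM2l// ler_nat.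
Qed.

(** Double counting: [h x] is divided by the size of its orbit and then counted once for each vertex
    of that orbit. *)
Lemma sum_orbit_mean h (S : set V) : finite_set S -> aut_invariant G S ->
  \sum_(v <- fset_set S) orbit_mean h v = \sum_(v <- fset_set S) h v.
Proof.
move=> fS Si; have oS := aut_invariant_orbit Si.
have fo v : S v -> finite_set (aut_orbit G v).
  by move=> /oS/sub_finite_set; apply.
pose c v : rat := #|` fset_set (aut_orbit G v)|%:R.
(* Indicators put all orbit sums over the one index set [fset_set S], so that the order of summation
   can be exchanged. *)
have sumo (F : V -> rat) v : S v -> \sum_(x <- fset_set (aut_orbit G v)) F x =
    \sum_(x <- fset_set S) (if `[< aut_orbit G v x >] then F x else 0).
  move=> Sv; rewrite -big_mkcond -big_filter; apply/perm_big/uniq_perm.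
  - exact: fset_uniq.
  - by apply: filter_uniq; exact: fset_uniq.
  - move=> x; rewrite mem_filter !in_fset_set//; last exact: fo.
    apply/idP/andP => [/set_mem vx|[/asboolP/mem_set//]].
    by split; [exact/asboolP|apply/mem_set/(oS v)].
transitivity (\sum_(v <- fset_set S) \sum_(x <- fset_set S)
    (if `[< aut_orbit G v x >] then h x / c x else 0)).
  apply: eq_big_seq => v; rewrite in_fset_set// inE => Sv.
  rewrite /orbit_mean sumo// mulr_suml; apply: eq_bigr => x _.
  by case: asboolP => [vx|]; rewrite ?mul0r// /c (orbit_eq vx).
rewrite exchange_big; apply: eq_big_seq => x; rewrite in_fset_set// inE => Sx.
transitivity (\sum_(v <- fset_set (aut_orbit G x)) h x / c x).
  rewrite sumo//; apply: eq_bigr => v _; congr (if _ then _ else _).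
  by apply: asbool_equiv_eq; split; exact: orbit_sym.
rewrite big_const_seq count_predT iter_addr_0 -mulr_natr mulfVK//.
by rewrite pnatr_eq0 -lt0n orbit_card_gt0//; exact: fo.
Qed.

End Averaging.

(** * Vertices of large orbit mean *)

Section Threshold.
Variables (V : choiceType) (G : graph V) (T : finType) (K : graph T).
Variables (M : set V).
Hypothesis Mfin : finite_set M.
Local Open Scope ring_scope.

Let mass := orbit_mean G (fun x => (x \in M)%:R).

Definition heavy : set V := [set v | #|T|%:R^-1 <= mass v].

(** Every translate of a copy is again a copy and so meets [M]: the indicator of [M] sums to at
    least [1] over each of them. *)
Lemma marked_mass (f : T -> V) :
  marked K G M -> embedding K G f -> 1 <= \sum_t mass (f t).
Proof.
move=> /marked_embedding Mm fe.
apply: (@sum_le_orbit_means _ _ _ _ _ (fset_set M)).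
  by move=> x; rewrite in_fset_set// => /negbTE ->.
move=> g ga; have [t Mt] := Mm _ (embedding_aut fe ga).
rewrite (bigD1 t)//= mem_set// lerDl sumr_ge0// => i _; exact: ler0n.
Qed.

Lemma heavy_invariant : aut_invariant G heavy.
Proof.
apply: orbit_aut_invariant => v Hv x vx.
by rewrite /heavy /= /mass (orbit_mean_orbit _ vx).
Qed.

Hypothesis T_gt0 : (0 < #|T|)%N.

Lemma sum_inv_card : \sum_(t : T) #|T|%:R^-1 = 1 :> rat.
Proof. by rewrite sumr_const -[LHS]mulr_natr mulVf// pnatr_eq0 -lt0n. Qed.

(** A positive mean forces the orbit to be finite and to meet the finite set [M]. *)
Lemma heavy_finite : finite_set heavy.
Proof.
pose D := M `&` [set x | finite_set (aut_orbit G x)].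
apply: (@sub_finite_set _ _ (\bigcup_(x in D) aut_orbit G x)); last first.
  by apply: bigcup_finite => [|x [_]//]; exact: finite_setIl.
move=> v Hv.
have mv : 0 < mass v by rewrite (lt_le_trans _ Hv)// invr_gt0 ltr0n.
have fv : finite_set (aut_orbit G v).
  by apply: contrapT => iv; move: mv; rewrite /mass orbit_mean_infinite// ltxx.
suff [x vx Mx] : exists2 x, aut_orbit G v x & M x.
  by exists x; [split=> //=; rewrite (orbit_eq vx)|exact: orbit_sym].
apply: contrapT => /forall2NP vM; move: mv.
rewrite /mass /orbit_mean big_seq big1 ?mul0r ?ltxx// => x.
rewrite in_fset_set// inE => vx.
by case: (vM x) => // Mx; rewrite memNset.
Qed.

Lemma heavy_marked : marked K G M -> marked K G heavy.
Proof.
move=> Mm; apply/marked_embedding => f fe; apply: contrapT => /forallNP nH.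
have := marked_mass Mm fe; apply/negP; rewrite -ltNge.
rewrite -sum_inv_card; apply: ltr_sum => [|t _].
  have /card_gt0P[t _] := T_gt0.
  by apply/hasP; exists t; rewrite ?mem_index_enum.
by have /negP := nH t; rewrite -ltNge.
Qed.

(** Averaging leaves the sum over the invariant set [heavy] unchanged, and there it counts vertices
    of [M]. *)
Lemma heavy_mass_le : \sum_(v <- fset_set heavy) mass v <= #|` fset_set M|%:R.
Proof.
rewrite (sum_orbit_mean _ heavy_finite heavy_invariant).
rewrite -natr_sum ler_nat.
rewrite (eq_bigr (fun v => if v \in M then 1%N else 0%N)); last first.
  by move=> v _; case: ifP.
rewrite -big_mkcond sum1_count -size_filter.
rewrite uniq_leq_size ?filter_uniq ?fset_uniq//.
by move=> x; rewrite mem_filter => /andP[xM _]; rewrite in_fset_set.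
Qed.

(** Markov's inequality: each vertex of [heavy] contributes at least [1 / #|T|] to the sum of the
    means. *)
Lemma heavy_card_le : (#|` fset_set heavy| <= #|T| * #|` fset_set M|)%N.
Proof.
rewrite -(ler_nat rat) natrM mulrC -ler_pdivrMr ?ltr0n//.
apply: le_trans heavy_mass_le.
rewrite mulrC mulr_natr -iter_addr_0 -count_predT -big_const_seq.
rewrite big_seq [leRHS]big_seq ler_sum// => v.
by rewrite in_fset_set ?inE//; exact: heavy_finite.
Qed.

Hypothesis heavy_card_ge :
  (#|T| * #|` fset_set M| <= #|` fset_set heavy|)%N.

(** The excesses over [1 / #|T|] are nonnegative on [heavy], yet by the size of [heavy] their sum is
    at most [0], so each vanishes. *)
Lemma mass_le v : mass v <= #|T|%:R^-1.
Proof.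
have [Hv|] := pselect (heavy v); last by move/negP; rewrite -ltNge => /ltW.
have H0 x : x \in fset_set heavy -> 0 <= mass x - #|T|%:R^-1.
  by rewrite in_fset_set ?inE ?subr_ge0//; exact: heavy_finite.
have : \sum_(x <- fset_set heavy) (mass x - #|T|%:R^-1) <= 0.
  rewrite sumrB subr_le0 (le_trans heavy_mass_le)//.
  rewrite big_const_seq count_predT iter_addr_0 -[leRHS]mulr_natl.
  rewrite ler_pdivlMr ?ltr0n//.
  by rewrite -natrM ler_nat mulnC.
have vH : v \in fset_set heavy.
  by rewrite in_fset_set ?inE//; exact: heavy_finite.
rewrite (bigD1_seq v)//= -[mass v <= _]subr_le0; apply: le_trans.
by rewrite lerDl big_seq_cond sumr_ge0// => x /andP[/H0].
Qed.

(** The [#|T|] means on a copy, none above [1 / #|T|], add up to at least [1], so each attains the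
    bound. *)
Lemma embedding_heavy (f : T -> V) :
  marked K G M -> embedding K G f -> range f `<=` heavy.
Proof.
move=> Mm fe _ [t _ <-]; rewrite /heavy /= -subr_ge0.
have : 0 <= \sum_i (mass (f i) - #|T|%:R^-1).
  by rewrite sumrB subr_ge0 sum_inv_card marked_mass.
rewrite (bigD1 t)//= => /le_trans; apply; rewrite gerDl.
by apply: sumr_le0 => i _; rewrite subr_le0 mass_le.
Qed.

End Threshold.

(** * The equality case: from one orbit to the whole graph *)

Lemma orbits_contain_copy (V : choiceType) (G : graph V) (T : finType)
    (K : graph T) (n m : nat) :
  connected G -> (exists x : T, pendant K x) ->
  upsilon K G n -> upsilon_sym K G m -> #|T| * n = m -> 0 < m ->
  forall v : V, contains_copy K (graph_of_subgraph (induced G (aut_orbit G v))).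
Proof.
move=> Gc [x Kx] [[M Mm Mn] _] [_ mmin] Tnm m0.
have Mfin : finite_set M by apply/finite_setP; exists n.
have cM := card_fset_set Mn.
have T0 : 0 < #|T| by move: m0; rewrite -Tnm muln_gt0 => /andP[].
pose S := heavy G T M.
have Sfin : finite_set S by exact: heavy_finite.
have Sinv : aut_invariant G S by exact: heavy_invariant.
(* [S] competes in the minimum defining [m], which puts it in the equality case. *)
have Sm : #|T| * #|` fset_set M| <= #|` fset_set S|.
  rewrite cM Tnm; apply: leq_card_fset_set => //; apply: mmin.
  by split=> //; exact: heavy_marked.
have fS f : embedding K G f -> range f `<=` S.
  by move=> fe; exact: embedding_heavy fe.
(* Without the orbit of [v], [S] stays invariant but has fewer than [m] vertices, so it misses some
   copy; this copy lies in [S], hence in the orbit. *)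
have copyS v : S v -> exists2 f, embedding K G f & range f `<=` aut_orbit G v.
  move=> Sv; have : ~ marked K G (S `\` aut_orbit G v).
    move=> Smark.
    have SO : aut_invariant G (S `\` aut_orbit G v).
      apply: orbit_aut_invariant => w [Sw nvw] y wy.
      split; first exact: (aut_invariant_orbit Sinv Sw).
      by move=> vy; apply: nvw; exact/(orbit_trans vy)/orbit_sym.
    have /(leq_card_fset_set (finite_setD _ Sfin)) := mmin _ (conj Smark SO).
    rewrite leqNgt -Tnm -cM => /negP; apply.
    apply: leq_trans (heavy_card_le G Mfin T0).
    apply: fproper_ltn_card; rewrite fproperE.
    have fSO := finite_setD (aut_orbit G v) Sfin.
    apply/andP; split; first by rewrite -fset_set_sub// => y [].
    apply/negP; rewrite -fset_set_sub// => /(_ v Sv)[_]; apply.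
    exact: orbit_refl.
  move=> /marked_embedding/existsNP[f /not_implyP[fe /forallNP nf]].
  exists f => // _ [t _ <-]; apply: contrapT => nvt.
  by apply: (nf t); split=> //; apply: fS fe _ _; exists t.
(* Some automorphism [g] takes [v] to the image of the pendant vertex's neighbour. Either [g w] is
   already on the copy, or the pendant vertex can be moved to it; in both cases a copy, and so [S],
   contains [g w]. *)
have Sadj v w : S v -> adj G v w -> S w.
  move=> Sv vw; have [f fe fv] := copyS v Sv.
  have [y xy _] := pendant_neighbor Kx.
  have [g ga gv] : aut_orbit G v (f y) by apply: fv; exists y.
  suff Sgw : S (g w).
    by apply: (aut_invariant_orbit Sinv Sgw); apply: orbit_sym; exists g.
  have yw : adj G (f y) (g w) by rewrite -gv -(ga.2 v w).
  have [|nfw] := pselect (range f (g w)); first exact: fS.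
  have [f' fe' <-] := embedding_move_pendant Kx xy fe yw nfw.
  by apply: fS fe' _ _; exists x.
have [v0 Sv0] : S !=set0.
  apply/set0P/eqP => S0; move: Sm.
  by rewrite S0 fset_set0 cardfs0 cM Tnm leqNgt m0.
have ST v : S v.
  by elim: (Gc v0 v) Sv0 => // [a b ab /Sadj|a b c _ ab _ bc /ab/bc//]; exact.
move=> v; have [f fe fv] := copyS v (ST v).
exact: contains_copy_induced fe fv.
Qed.

Theorem theorem2p2 (V : Type) (G : graph V) (T : finType) (K : graph T)
    (n m : nat) :
  connected G ->
  connected K ->
  (exists x : T, pendant K x) ->
  upsilon K G n ->
  upsilon_sym K G m ->
  #|T| * n = m ->
  0 < m ->
  forall v : V, contains_copy K (graph_of_subgraph (induced G (aut_orbit G v))).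
(* [{classic V}] gives [V] the choice structure on which the finite sums rely. *)
Proof. by move=> Gc _; exact: (@orbits_contain_copy {classic V}). Qed.
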